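(* Let $L$ be a finite distributive lattice with rank function $r$, and let $\alpha,\beta,\gamma,\delta: L \to [0,\infty)$ satisfy \[ \alpha(x)\beta(y) \leq \gamma(x \vee y)\,\delta(x \wedge y) \quad \text{for all } x,y \in L. \] Then for all subsets $X,Y \subseteq L$, \[ \Big(\sum_{x \in X} \alpha(x)q^{r(x)}\Big)\Big( \sum_{x \in Y} \beta(x)q^{r(x)}\Big) \ll \Big(\sum_{x \in X \vee Y} \gamma(x)q^{r(x)}\Big)\Big( \sum_{x \in X \wedge Y} \delta(x)q^{r(x)}\Big), \] as polynomials in the indeterminate $q$.
   Context: For a finite lattice $L$ and $x \in L$, the rank $r(x)$ is the length (number of strict inequalities) of a longest chain in $L$ having $x$ as its maximal element; so the minimum element has rank $0$. For $X,Y \subseteq L$, $X \vee Y = \{x \vee y : x \in X, y \in Y\}$ and $X \wedge Y = \{x \wedge y : x \in X, y \in Y\}$. For real polynomials $P(q),R(q)$, $P(q) \ll R(q)$ means that every coefficient of $R(q)-P(q)$ is a non-negative real number. *)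

(* Defs.v *)
From HB Require Import structures.
From mathcomp Require Import all_boot all_order all_algebra.
Set Implicit Arguments. Unset Strict Implicit. Unset Printing Implicit Defensive.
Import Order.TTheory GRing.Theory Num.Theory.
Local Open Scope order_scope.

Definition is_chain (d : Order.disp_t) (L : finPOrderType d) (C : {set L}) : bool :=
  [forall x in C, forall y in C, ((x <= y)%O || (y <= x)%O)].

(* rank x = length (number of strict inequalities, i.e. #|C| - 1) of a longest
   chain C having x as its maximal element. *)
Definition rank (d : Order.disp_t) (L : finPOrderType d) (x : L) : nat :=
  (\max_(C : {set L} | [&& is_chain C, x \in C & [forall y in C, (y <= x)%O]])
     (#|C| - 1))%N.

Definition setJoin (d : Order.disp_t) (L : finLatticeType d) (X Y : {set L}) : {set L} :=
  [set x `|` y | x in X, y in Y].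
Definition setMeet (d : Order.disp_t) (L : finLatticeType d) (X Y : {set L}) : {set L} :=
  [set x `&` y | x in X, y in Y].

Local Open Scope ring_scope.

Definition poly_ll (R : realFieldType) (P Q : {poly R}) : Prop :=
  forall i : nat, 0 <= (Q - P)`_i.

Definition rank_gen (d : Order.disp_t) (L : finLatticeType d) (R : realFieldType)
  (f : L -> R) (X : {set L}) : {poly R} :=
  \sum_(x in X) f x *: 'X^(rank x).

(* Main.v *)
(** Map [L] into the Boolean lattice of its subsets by sending [x] to the set of
    join-primes below [x]; this turns rank into cardinality and reduces the
    claim to sets. There, the coefficient of [q^n] splits according to
    [(M, J) = (A :&: B, A :|: B)], and the inequality holds for each [(M, J)]
    separately. Indeed, let [A'] be the complement of [A] in the interval
    [[M, J]], [F A = a A * b A'] and [G A = c A * d A']. Regrouping factors gives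
    [F A * F B' <= G (A :|: B) * G (A :&: B)'], so the classical four functions
    theorem yields [(\sum F) ^ 2 <= (\sum G) ^ 2]. *)
Require Import Defs.
From HB Require Import structures.
From mathcomp Require Import all_boot all_order all_algebra.
From mathcomp Require Import ring lra.
Set Implicit Arguments. Unset Strict Implicit. Unset Printing Implicit Defensive.
Import Order.TTheory GRing.Theory Num.Theory.
Local Open Scope ring_scope.

(** * The four functions theorem for subsets of a finite set *)

(** The one-point case: the index records whether the point is present. The products [a0 * b0] and
    [a1 * b1] have their own bounds on the right, so only the mixed products remain to be
    compared. *)
Lemma four_numbers (R : realFieldType) (a0 a1 b0 b1 c0 c1 d0 d1 : R) :
  0 <= a0 -> 0 <= a1 -> 0 <= b0 -> 0 <= b1 ->
  0 <= c0 -> 0 <= c1 -> 0 <= d0 -> 0 <= d1 ->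
  a0 * b0 <= c0 * d0 -> a0 * b1 <= c1 * d0 ->
  a1 * b0 <= c1 * d0 -> a1 * b1 <= c1 * d1 ->
  (a0 + a1) * (b0 + b1) <= (c0 + c1) * (d0 + d1).
Proof.
move=> a0_ge0 a1_ge0 b0_ge0 b1_ge0 c0_ge0 c1_ge0 d0_ge0 d1_ge0 h00 h01 h10 h11.
suff: a0 * b1 + a1 * b0 <= c1 * d0 + c0 * d1 by lra.
have P_ge0 : 0 <= a0 * b1 by exact: mulr_ge0.
have Q_ge0 : 0 <= a1 * b0 by exact: mulr_ge0.
have V_ge0 : 0 <= c0 * d1 by exact: mulr_ge0.
have PQ : (a0 * b1) * (a1 * b0) <= (c1 * d0) * (c0 * d1).
  have -> : (a0 * b1) * (a1 * b0) = (a0 * b0) * (a1 * b1) by ring.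
  have -> : (c1 * d0) * (c0 * d1) = (c0 * d0) * (c1 * d1) by ring.
  by apply: ler_pM => //; apply: mulr_ge0.
(* Now [P, Q <= U] and [P Q <= U V]; expand [0 <= (U - P) (U - Q)]. *)
move: (a0 * b1) (a1 * b0) (c1 * d0) (c0 * d1) h01 h10 P_ge0 Q_ge0 V_ge0 PQ.
move=> P Q U V PU QU P_ge0 Q_ge0 V_ge0 PQ.
have [U_gt0|U_le0] := ltP 0 U; last by lra.
rewrite -(ler_pM2l U_gt0).
have : 0 <= (U - P) * (U - Q) by apply: mulr_ge0; rewrite subr_ge0.
by lra.
Qed.

Lemma sum_subsets_setU1 (R : nmodType) (T : finType) (t : T) (D : {set T})
    (f : {set T} -> R) :
  t \notin D ->
  \sum_(A : {set T} | A \subset t |: D) f A =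
  \sum_(A : {set T} | A \subset D) (f A + f (t |: A)).
Proof.
move=> tD; rewrite big_split /= (bigID (fun A : {set T} => t \notin A)) /=.
congr (_ + _).
  apply: eq_bigl => A; apply/andP/idP => [[AtD tA]|AD].
    by rewrite -(setU1K tD) subsetD1 AtD.
  by rewrite (subset_trans AD (subsetUr _ _)) (contra (subsetP AD t)).
rewrite (reindex_onto (fun A => t |: A) (fun A => A :\ t)) /=; last first.
  by move=> A /andP[_ /negPn tA]; rewrite setD1K.
apply: eq_bigl => A; rewrite setU11 andbT; apply/andP/idP => [[AtD /eqP AE]|AD].
  by rewrite -AE -(setU1K tD) setSD.
have tA := contra (subsetP AD t) tD.
by rewrite setUS // setU1K.
Qed.

(** Induction on [#|D|]: delete a point [t] and replace each [f] by [f A + f (t |: A)], which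
    preserves its total. The new functions inherit the hypothesis by [four_numbers], whose four
    inequalities correspond to adding [t] or not to [A] and to [B]. *)
Theorem four_functions_set (R : realFieldType) (T : finType) (D : {set T})
    (a b c d : {set T} -> R) :
  (forall A, 0 <= a A) -> (forall A, 0 <= b A) ->
  (forall A, 0 <= c A) -> (forall A, 0 <= d A) ->
  (forall A B : {set T}, A \subset D -> B \subset D ->
     a A * b B <= c (A :|: B) * d (A :&: B)) ->
  (\sum_(A : {set T} | A \subset D) a A) * (\sum_(A : {set T} | A \subset D) b A)
  <= (\sum_(A : {set T} | A \subset D) c A) * (\sum_(A : {set T} | A \subset D) d A).
Proof.
have [n] := ubnP #|D|; elim: n D a b c d => // n IH D a b c d /ltnSE leDn.
have [->|[t tD0]] := set_0Vmem D => a0 b0 c0 d0 abcd.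
  have E (f : {set T} -> R) : \sum_(A : {set T} | A \subset set0) f A = f set0.
    by rewrite (eq_bigl _ _ (@subset0 _)) big_pred1_eq.
  rewrite !E; have := abcd _ _ (sub0set set0) (sub0set set0).
  by rewrite setU0 setI0.
move: leDn abcd; rewrite -(setD1K tD0) cardsU1 setD11.
have : t \notin D :\ t by rewrite setD11.
move: (D :\ t) => {D tD0} D tD ltDn abcd.
rewrite !sum_subsets_setU1 //; apply: IH => // [A|A|A|A|A B AD BD];
  try exact: addr_ge0.
have AtD := subset_trans AD (subsetUr [set t] D).
have BtD := subset_trans BD (subsetUr [set t] D).
have tAtD := setUS [set t] AD; have tBtD := setUS [set t] BD.
have tA := contra (subsetP AD t) tD; have tB := contra (subsetP BD t) tD.
apply: four_numbers => //.
- exact: abcd.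
- have := abcd A (t |: B) AtD tBtD; rewrite setUCA setIUr.
  by rewrite (_ : A :&: [set t] = set0) ?set0U //; apply/disjoint_setI0;
    rewrite disjoint_sym disjoints1.
- have := abcd (t |: A) B tAtD BtD; rewrite -setUA setIUl.
  by rewrite (_ : [set t] :&: B = set0) ?set0U //; apply/disjoint_setI0;
    rewrite disjoints1.
- by have := abcd (t |: A) (t |: B) tAtD tBtD; rewrite -setUUr -setUIr.
Qed.

(** * Relative complements in an interval of sets *)

Section IntervalComplement.
Variables (T : finType) (M J : {set T}).

Definition inItv (A : {set T}) := (M \subset A) && (A \subset J).
Definition icompl (A : {set T}) := M :|: (J :\: A).

Lemma icomplU A B : icompl (A :|: B) = icompl A :&: icompl B.
Proof. by rewrite /icompl setDUr setUIr. Qed.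

Lemma icomplI A B : icompl (A :&: B) = icompl A :|: icompl B.
Proof. by rewrite /icompl setDIr setUUr. Qed.

Lemma inItv_icompl A : inItv A -> inItv (icompl A).
Proof.
move=> /andP[MA AJ]; rewrite /inItv subsetUl subUset subsetDl andbT.
exact: subset_trans AJ.
Qed.

Lemma icomplK A : inItv A -> icompl (icompl A) = A.
Proof.
move=> /andP[/subsetP MA /subsetP AJ]; apply/setP => x; rewrite !inE.
move/implyP: (MA x); move/implyP: (AJ x).
by case: (x \in A); case: (x \in M); case: (x \in J).
Qed.

Lemma inItvU A B : inItv A -> inItv B -> inItv (A :|: B).
Proof.
move=> /andP[MA AJ] /andP[_ BJ].
by rewrite /inItv subUset AJ BJ (subset_trans MA (subsetUl _ _)).
Qed.

Lemma inItvI A B : inItv A -> inItv B -> inItv (A :&: B).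
Proof.
move=> /andP[MA AJ] /andP[MB _].
by rewrite /inItv subsetI MA MB (subset_trans (subsetIl _ _) AJ).
Qed.

(** Relative complements in a Boolean interval are unique, so the pairs with meet [M] and join [J]
    are parametrised by their first member. *)
Lemma meet_join_icompl A B :
  ((A :&: B == M) && (A :|: B == J)) = inItv A && (B == icompl A).
Proof.
apply/andP/andP => [|[AI /eqP ->]].
  rewrite /inItv /icompl => -[/eqP <- /eqP <-]; rewrite subsetIl subsetUl.
  split=> //.
  by apply/eqP/setP => x; rewrite !inE; case: (x \in A); case: (x \in B).
move: AI => /andP[/subsetP MA /subsetP AJ].
split; apply/eqP/setP => x; rewrite !inE;
  move/implyP: (MA x); move/implyP: (AJ x);
  by case: (x \in A); case: (x \in M); case: (x \in J).
Qed.

Lemma sum_icompl_le (R : realFieldType) (a b c d : {set T} -> R) :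
  (forall A, 0 <= a A) -> (forall A, 0 <= b A) ->
  (forall A, 0 <= c A) -> (forall A, 0 <= d A) ->
  (forall A B, a A * b B <= c (A :|: B) * d (A :&: B)) ->
  \sum_(A | inItv A) a A * b (icompl A) <= \sum_(A | inItv A) c A * d (icompl A).
Proof.
move=> a0 b0 c0 d0 abcd.
(* On the interval [ext a b A] is [F A] and [extc a b A] is [F A']; both are 0 elsewhere, so that
   sums may run over all sets. Complementation permutes the interval, hence the two have equal sums
   and the four functions inequality compares squares. *)
pose ext (f g : {set T} -> R) A := if inItv A then f A * g (icompl A) else 0.
pose extc f g A := if inItv A then ext f g (icompl A) else 0.
have ext0 f g A : (forall A, 0 <= f A) -> (forall A, 0 <= g A) -> 0 <= ext f g A.
  by move=> f0 g0; rewrite /ext; case: ifP => // _; apply: mulr_ge0.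
have extc0 f g A : (forall A, 0 <= f A) -> (forall A, 0 <= g A) -> 0 <= extc f g A.
  by move=> f0 g0; rewrite /extc; case: ifP => // _; apply: ext0.
have sum_ext f g : \sum_(A : {set T} | A \subset setT) ext f g A
    = \sum_(A | inItv A) f A * g (icompl A).
  by rewrite [RHS]big_mkcond; apply: eq_bigl => A; rewrite subsetT.
have sum_extc f g : \sum_(A : {set T} | A \subset setT) extc f g A
    = \sum_(A | inItv A) f A * g (icompl A).
  transitivity (\sum_(A | inItv A) ext f g (icompl A)).
    by rewrite [RHS]big_mkcond; apply: eq_bigl => A; rewrite subsetT.
  rewrite [RHS](reindex_onto icompl icompl); last exact: icomplK.
  rewrite [LHS]big_mkcond [RHS]big_mkcond; apply: eq_bigr => A _.
  have [AI|AI] := boolP (inItv A).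
    by rewrite icomplK // inItv_icompl // eqxx /ext inItv_icompl // icomplK.
  case: ifP => // /andP[AI' /eqP AE].
  by move: AI; rewrite -AE inItv_icompl.
have := @four_functions_set R T setT (ext a b) (extc a b) (ext c d) (extc c d).
rewrite !sum_ext !sum_extc => four.
suff : forall A B, ext a b A * extc a b B <= ext c d (A :|: B) * extc c d (A :&: B).
  move=> extP; have {four} := four _ _ _ _ (fun A B _ _ => extP A B).
  rewrite -!expr2 ler_sqr ?nnegrE; last 2 first.
  - by apply: sumr_ge0 => A _; apply: mulr_ge0.
  - by apply: sumr_ge0 => A _; apply: mulr_ge0.
  by apply; move=> A; auto.
move=> A B.
have rhs0 : 0 <= ext c d (A :|: B) * extc c d (A :&: B).
  by apply: mulr_ge0; auto.
have [AI|AI] := boolP (inItv A); last by rewrite /ext (negPf AI) mul0r.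
have [BI|BI] := boolP (inItv B); last by rewrite /extc (negPf BI) mulr0.
rewrite /extc /ext BI AI inItvU // inItvI // !inItv_icompl ?inItvI //.
rewrite !icomplK ?inItvI // icomplU icomplI.
(* Regrouped so that the hypothesis applies once to [(A, B)] and once to [(icompl B, icompl A)]. *)
have -> : a A * b (icompl A) * (a (icompl B) * b B)
    = (a A * b B) * (a (icompl B) * b (icompl A)).
  by ring.
have -> : c (A :|: B) * d (icompl A :&: icompl B) *
    (c (icompl A :|: icompl B) * d (A :&: B))
  = (c (A :|: B) * d (A :&: B)) *
    (c (icompl B :|: icompl A) * d (icompl B :&: icompl A)).
  by rewrite [icompl B :|: _]setUC [icompl B :&: _]setIC; ring.
by apply: ler_pM => //; apply: mulr_ge0.
Qed.

End IntervalComplement.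

(** * Pairs of sets of prescribed total size *)

(** Cardinality is modular, so [mj] preserves the total size of a pair. Both sums therefore split
    over the fibres of [mj], and [sum_icompl_le] compares them fibre by fibre. *)
Lemma four_functions_card (R : realFieldType) (T : finType)
    (a b c d : {set T} -> R) (n : nat) :
  (forall A, 0 <= a A) -> (forall A, 0 <= b A) ->
  (forall A, 0 <= c A) -> (forall A, 0 <= d A) ->
  (forall A B, a A * b B <= c (A :|: B) * d (A :&: B)) ->
  \sum_(p : {set T} * {set T} | (#|p.1| + #|p.2|)%N == n) a p.1 * b p.2 <=
  \sum_(p : {set T} * {set T} | (#|p.1| + #|p.2|)%N == n) c p.1 * d p.2.
Proof.
move=> a0 b0 c0 d0 abcd.
pose mj (p : {set T} * {set T}) := (p.1 :&: p.2, p.1 :|: p.2).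
have cardmj p : (#|(mj p).1| + #|(mj p).2|)%N = (#|p.1| + #|p.2|)%N.
  by rewrite addnC cardsUI.
have split_mj (f g : {set T} -> R) :
    \sum_(p : {set T} * {set T} | (#|p.1| + #|p.2|)%N == n) f p.1 * g p.2 =
    \sum_(q : {set T} * {set T} | (#|q.1| + #|q.2|)%N == n)
      \sum_(A | inItv q.1 q.2 A) f A * g (icompl q.1 q.2 A).
  rewrite (partition_big mj (fun q => (#|q.1| + #|q.2|)%N == n)) /=; last first.
    by move=> p; rewrite cardmj.
  apply: eq_bigr => -[M J] /= MJn.
  transitivity (\sum_(p : {set T} * {set T} | inItv M J p.1 && (p.2 == icompl M J p.1))
     f p.1 * g p.2).
    apply: eq_bigl => p; rewrite -meet_join_icompl -cardmj /mj xpair_eqE /=.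
    by apply: andb_idl => /andP[/eqP-> /eqP->].
  rewrite -(pair_big_dep (inItv M J) (fun A B => B == icompl M J A)
    (fun A B => f A * g B)) /=.
  by apply: eq_bigr => A _; rewrite big_pred1_eq.
by rewrite !split_mj; apply: ler_sum => q _; apply: sum_icompl_le.
Qed.

(** * Extremal elements and rank in finite posets *)

Lemma exists_minimal (d : Order.disp_t) (L : finPOrderType d) (P : pred L) x :
  P x ->
  exists2 m, P m & forall y, P y -> ~~ (y < m)%O.
Proof.
move=> Px; have [m Pm min] := arg_minnP (fun z => #|[set y : L | (y < z)%O]|) Px.
exists m => // y Py; apply/negP => ym.
have := min y Py; rewrite leqNgt => /negP[]; apply: proper_card.
apply/properP; split; last by exists y; rewrite !inE ?ltxx.
by apply/subsetP => z; rewrite !inE => /lt_trans; apply.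
Qed.

Lemma exists_maximal (d : Order.disp_t) (L : finPOrderType d) (P : pred L) x :
  P x ->
  exists2 m, P m & forall y, P y -> ~~ (m < y)%O.
Proof.
move=> Px; have [m Pm min] := arg_minnP (fun z => #|[set y : L | (z < y)%O]|) Px.
exists m => // y Py; apply/negP => my.
have := min y Py; rewrite leqNgt => /negP[]; apply: proper_card.
apply/properP; split; last by exists y; rewrite !inE ?ltxx.
by apply/subsetP => z; rewrite !inE; apply: lt_trans.
Qed.

Lemma rank_lt (d : Order.disp_t) (L : finPOrderType d) (x y : L) :
  (y < x)%O -> (rank y < rank x)%N.
Proof.
move=> yx; pose below z (C : {set L}) :=
  [&& is_chain C, z \in C & [forall w in C, (w <= z)%O]].
(* Some chain ends at [y], so the maximum defining [rank y] is attained, by a chain that [x] then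
   extends. *)
have y1 : below y [set y].
  rewrite /below inE eqxx; apply/andP; split.
    apply/forallP => u; apply/implyP => /set1P->.
    by apply/forallP => v; apply/implyP => /set1P->; rewrite lexx.
  by apply/forallP => u; apply/implyP => /set1P->; rewrite lexx.
have [C] := eq_bigmax_cond (fun C : {set L} => #|C| - 1)%N
  (introT card_gt0P (ex_intro (fun C => C \in below y) _ y1)).
move=> /and3P[/forallP chain yC /forallP Cy] E.
rewrite /rank E; have xC : x \notin C.
  by apply/negP => xC; have := Cy x; rewrite xC lt_geF.
have Cle z : z \in C -> (z <= x)%O.
  by move=> zC; have := Cy z; rewrite zC => /le_trans; apply; apply: ltW.
(* The truncated subtraction is harmless because [C] contains [y]. *)
have -> : (#|C| - 1).+1 = (#|x |: C| - 1)%N.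
  by rewrite cardsU1 xC addKn subn1 prednK // (cardD1 y) yC.
apply: (@leq_bigmax_cond _ _ (fun C : {set L} => #|C| - 1)%N).
rewrite setU11 /=; apply/andP; split; last first.
  by apply/forallP => u; apply/implyP => /setU1P[->//|/Cle].
apply/forallP => u; apply/implyP => uC; apply/forallP => v; apply/implyP => vC.
case/setU1P: uC => [->|uC]; case/setU1P: vC => [->|vC]; rewrite ?lexx ?Cle ?orbT //.
by have := chain u; rewrite uC => /forallP/(_ v); rewrite vC.
Qed.

(** * Birkhoff's representation by join-primes, and rank as cardinality *)

Section JoinPrimes.
Variables (d : Order.disp_t) (L : finDistrLatticeType d).
Implicit Types x y p q : L.

(* The first conjunct says that [p] is not the bottom, which the signature of [L]
   does not provide since [L] may be empty. *)
Definition join_prime p :=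
  [exists x : L, ~~ (p <= x)%O] &&
  [forall x : L, forall y : L, (p <= x `|` y)%O ==> (p <= x)%O || (p <= y)%O].

Definition primes_below x : {set L} := [set p | join_prime p & (p <= x)%O].

Lemma join_primeU p x y : join_prime p -> (p <= x `|` y)%O = (p <= x)%O || (p <= y)%O.
Proof.
move=> /andP[_ /forallP/(_ x)/forallP/(_ y)/implyP pxy].
by apply/idP/idP => // /orP[]; [apply: lexUl | apply: lexUr].
Qed.

Lemma primes_belowU x y : primes_below (x `|` y)%O = primes_below x :|: primes_below y.
Proof.
apply/setP => p; rewrite !inE; case: (boolP (join_prime p)) => //= pp.
exact: join_primeU.
Qed.

Lemma primes_belowI x y : primes_below (x `&` y)%O = primes_below x :&: primes_below y.
Proof. by apply/setP => p; rewrite !inE lexI; case: (join_prime p). Qed.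

(** There are enough join-primes to separate elements: if [x] is not below [y], take [p] minimal
    among the elements below [x] but not below [y]. Everything strictly below [p] is below [y]. If
    [p] were below [u] joined with [v] but below neither, distributivity would make it the join of
    its meets with [u] and [v], hence below [y]. *)
Lemma primes_belowS x y : (primes_below x \subset primes_below y) = (x <= y)%O.
Proof.
apply/idP/idP => [/subsetP sxy|xy]; last first.
  by apply/subsetP => p; rewrite !inE => /andP[-> /le_trans]; apply.
apply: contraT => nxy.
have [p /andP[px npy] min] :=
  @exists_minimal _ L (fun z => (z <= x)%O && ~~ (z <= y)%O) x (introT andP (conj (lexx x) nxy)).
have low z : (z < p)%O -> (z <= y)%O.
  move=> zp; apply: contraT => nzy; have := min z; rewrite nzy zp.
  by rewrite (le_trans (ltW zp) px) => /(_ isT).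
suff : p \in primes_below y by rewrite inE (negPf npy) andbF.
apply: sxy; rewrite inE px andbT; apply/andP; split.
  by apply/existsP; exists y.
apply/forallP => u; apply/forallP => v; apply/implyP => puv.
apply: contraT; rewrite negb_or => /andP[npu npv].
have ltI w : ~~ (p <= w)%O -> (p `&` w < p)%O.
  by move=> npw; rewrite lt_neqAle leIl andbT; apply: contra npw => /eqP/meet_idPl.
have : (p <= y)%O.
  by rewrite -[p](meet_idPl puv) meetUr leUx !low ?ltI.
by rewrite (negPf npy).
Qed.

Lemma primes_below_inj : injective primes_below.
Proof.
by move=> x y /eqP; rewrite eqEsubset !primes_belowS => /le_anti.
Qed.

Lemma card_primes_below_lt x y : (x < y)%O -> (#|primes_below x| < #|primes_below y|)%N.
Proof.
move=> xy; apply: proper_card; rewrite properE !primes_belowS (ltW xy) /=.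
by rewrite lt_geF.
Qed.

(** Exactly one join-prime is gained: if [p] and [q] are both new, then [q] joined with [y] is [x],
    which lies above [p]. Primality gives [p] below [q], and symmetry gives equality. *)
Lemma card_primes_below_cover x y :
  (y < x)%O -> (forall z, (z < x)%O -> ~~ (y < z)%O) ->
  #|primes_below x| = #|primes_below y|.+1.
Proof.
move=> yx max.
have sub : primes_below y \subset primes_below x by rewrite primes_belowS ltW.
have cover p : (p <= x)%O -> ~~ (p <= y)%O -> (y `|` p)%O = x.
  move=> px npy; apply/eqP; have := max (y `|` p)%O.
  rewrite lt_neqAle leUx (ltW yx) px andbT; case: eqP => // _ /(_ isT).
  rewrite lt_neqAle leUl andbT negbK => /eqP yE.
  by move: npy; rewrite yE leUr.
suff : #|primes_below x :\: primes_below y| == 1%N.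
  by rewrite cardsD (setIidPr sub) -(eqn_add2r #|primes_below y|) subnK
    ?subset_leq_card // => /eqP.
apply/cards1P.
have /set0Pn[p pD] : primes_below x :\: primes_below y != set0.
  by rewrite setD_eq0 primes_belowS lt_geF.
exists p; apply/eqP; rewrite eqEsubset sub1set pD andbT; apply/subsetP => q.
have le u v : u \in primes_below x :\: primes_below y ->
    v \in primes_below x :\: primes_below y -> (u <= v)%O.
  rewrite !inE => /andP[nu /andP[uu ux]] /andP[nv /andP[vv vx]].
  rewrite uu /= in nu; rewrite vv /= in nv.
  by move: ux; rewrite -{1}(cover v) // join_primeU // (negPf nu).
by move=> qD; rewrite inE; apply/eqP/le_anti; rewrite !le.
Qed.

Lemma rank_le_card x : (rank x <= #|primes_below x|)%N.
Proof.
apply/bigmax_leqP => C /and3P[/forallP chain xC /forallP Cx].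
have inj : {in C &, injective (fun y => #|primes_below y|)}.
  move=> y z yC zC E; have := chain y; rewrite yC => /forallP/(_ z); rewrite zC /=.
  by rewrite !le_eqVlt => /orP[/orP[/eqP //|]|/orP[/eqP //|]] /card_primes_below_lt;
    rewrite E ltnn.
(* Along a chain below [x] the number of join-primes strictly increases, with values from 0 to
   [#|primes_below x|]. The extra value 0 is absorbed by the [- 1] in [rank]. *)
pose f y : 'I_(#|primes_below x|).+1 := inord #|primes_below y|.
have fE y : y \in C -> f y = #|primes_below y| :> nat.
  move=> yC; rewrite inordK // ltnS subset_leq_card // primes_belowS.
  by have := Cx y; rewrite yC.
have : (#|f @: C| <= #|primes_below x|.+1)%N.
  by rewrite -[X in (_ <= X)%N]card_ord max_card.
rewrite card_in_imset ?leq_subLR //.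
by move=> y z yC zC E; apply: inj => //=; rewrite -(fE y) // -(fE z) // E.
Qed.

(** For the lower bound, descend to an element covered by [x]: the number of join-primes drops by
    exactly one and the rank by at least one. *)
Lemma rankE x : rank x = #|primes_below x|.
Proof.
apply/eqP; rewrite eqn_leq rank_le_card /=.
have [n] := ubnP #|primes_below x|; elim: n x => // n IH x /ltnSE le_n.
have [/existsP[y0 y0x]|/existsPn minx] := boolP [exists y : L, (y < x)%O].
  have [y yx max] := @exists_maximal _ L (fun z => (z < x)%O) y0 y0x.
  move: le_n; rewrite (card_primes_below_cover yx max) => le_n.
  exact: leq_ltn_trans (IH y le_n) (rank_lt yx).
(* A minimal element of a lattice is the least one, so a join-prime below it would be below
   everything, against the first conjunct of [join_prime]. *)
rewrite (_ : primes_below x = set0) ?cards0 //; apply/setP => p.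
rewrite !inE; apply/negbTE/negP => /andP[/andP[/existsP[z pz] _] px].
have : ~~ (x <= z)%O by apply: contra pz; apply: le_trans.
move=> xz; have := minx (x `&` z)%O.
by rewrite lt_neqAle leIl andbT negbK => /eqP/meet_idPl; rewrite (negPf xz).
Qed.

(** * Transfer of functions from the lattice to its subsets *)

Section Push.
Variable R : realFieldType.

(** Extension by zero along an embedding: [primes_below] is injective, so the sum has at most one
    term. *)
Definition push (f : L -> R) (X : {set L}) (A : {set L}) : R :=
  \sum_(x in X | primes_below x == A) f x.

Lemma push_ge0 f X A : (forall x, 0 <= f x) -> 0 <= push f X A.
Proof. by move=> f0; apply: sumr_ge0. Qed.

Lemma pushE f (X : {set L}) x : x \in X -> push f X (primes_below x) = f x.
Proof.
move=> xX; rewrite /push (big_pred1 x) // => y.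
by rewrite (inj_eq primes_below_inj) /=; case: eqP => [->|]; rewrite ?xX ?andbF.
Qed.

Lemma push_out f (X A : {set L}) : A \notin primes_below @: X -> push f X A = 0.
Proof.
move=> AX; apply: big_pred0 => x; apply/negbTE/negP => /andP[xX /eqP xA].
by move: AX; rewrite -xA imset_f.
Qed.

Lemma rank_gen_push f X :
  rank_gen f X = \sum_(A : {set L}) push f X A *: 'X^#|A|.
Proof.
rewrite /rank_gen (partition_big primes_below xpredT) //=.
apply: eq_bigr => A _; rewrite scaler_suml.
by apply: eq_bigr => x /andP[_ /eqP <-]; rewrite rankE.
Qed.

Lemma coef_rank_genM f g X Y n :
  (rank_gen f X * rank_gen g Y)`_n =
  \sum_(p : {set L} * {set L} | (#|p.1| + #|p.2|)%N == n) push f X p.1 * push g Y p.2.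
Proof.
rewrite !rank_gen_push big_distrlr /= pair_big /= coef_sum [RHS]big_mkcond /=.
apply: eq_bigr => p _.
rewrite -scalerAl -scalerAr scalerA -exprD coefZ coefXn eq_sym.
by case: ifP; rewrite ?mulr1 ?mulr0.
Qed.

End Push.
End JoinPrimes.

Theorem theorem1p5 (d : Order.disp_t) (L : finDistrLatticeType d) (R : realFieldType)
  (alpha beta gamma delta : L -> R)
  (ha : forall x, 0 <= alpha x) (hb : forall x, 0 <= beta x)
  (hc : forall x, 0 <= gamma x) (hd : forall x, 0 <= delta x)
  (hineq : forall x y : L,
     alpha x * beta y <= gamma (Order.join x y) * delta (Order.meet x y))
  (X Y : {set L}) :
  poly_ll (rank_gen alpha X * rank_gen beta Y)
          (rank_gen gamma (setJoin X Y) * rank_gen delta (setMeet X Y)).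
Proof.
move=> n; rewrite coefB subr_ge0 !coef_rank_genM.
apply: four_functions_card => [A|A|A|A|A B]; try exact: push_ge0.
(* Non-negativity of the right side settles the case where a left factor vanishes. Otherwise [A] and
   [B] are images of some [x] in [X] and [y] in [Y], and [hineq] applies. *)
have rhs0 C D : 0 <= push gamma (setJoin X Y) C * push delta (setMeet X Y) D.
  by apply: mulr_ge0; apply: push_ge0.
have [/imsetP[x xX ->]|AX] := boolP (A \in @primes_below _ L @: X); last first.
  by rewrite (push_out alpha AX) mul0r.
have [/imsetP[y yY ->]|BY] := boolP (B \in @primes_below _ L @: Y); last first.
  by rewrite (push_out beta BY) mulr0.
rewrite -primes_belowU -primes_belowI !pushE ?hineq //.
  exact: imset2_f.
exact: imset2_f.
Qed.
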